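(* Let $N\ge 2$ and let $F:\mathbb{T}^N\to\mathbb{T}^N$ be a non-singular map which commutes with every $\pi\in\Pi_{N-1}$. Let $\widehat F=P\circ F\circ P^{-1}$ and let $\mathcal{F}$ be the projected map, defined on $I_N\cap\widehat F^{-1}D_\ast^N$ by $\mathcal{F}u=\pi_{\widehat F u}(\widehat F u)$. (i) Assume that $\mathcal{F}$ has two disjoint forward invariant sets in $I_N\cap\widehat F^{-1}D_\ast^N$. Then $\widehat F$ has two disjoint forward invariant sets in $D_\ast^N$, and hence $F$ has two disjoint forward invariant sets in $\mathbb{T}_\ast^N$. (ii) If $F$ is a non-singular piecewise affine map, then there exist atomic collections in $D_\ast^N$ and in $I_N$ respectively so that $\widehat F$ and $\mathcal{F}$ are non-singular piecewise affine maps. Moreover, if $\mathcal{F}$ has two disjoint IUP in $I_N\cap\widehat F^{-1}D_\ast^N$, then $\widehat F$ has two disjoint IUP in $D_\ast^N\cap\widehat F^{-1}D_\ast^N$, and hence $F$ has two disjoint IUP in $\mathbb{T}_\ast^N\cap F^{-1}\mathbb{T}_\ast^N$.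
   Context: $\mathbb{T}^N=(\mathbb{R}/\mathbb{Z})^N$; $[m,n]$ denotes the set of integers from $m$ to $n$ when used for indices. A map is non-singular if preimages of zero Lebesgue measure sets have zero Lebesgue measure. $\Pi_{N-1}$ is the group of permutations of the first $N-1$ coordinates; the same symbol $\pi\in\Pi_{N-1}$ is used for its action on $\mathbb{T}^N$ and on $\mathbb{R}^N$. $\mathbb{T}_\ast^N=\{\mathrm{u}\in\mathbb{T}^N:\mathrm{u}_i\ne\mathrm{u}_j \bmod 1,\ \forall i\ne j\in[1,N]\}$. The map $P:\mathbb{T}^N\to\mathbb{R}^N$ is $(P\mathrm{u})_i=\mathrm{u}_i+\lfloor\mathrm{u}_N-\mathrm{u}_i\rfloor-\lfloor\mathrm{u}_N\rfloor$, $i\in[1,N]$ (computed with any real representatives; the result does not depend on them). It is one-to-one and its inverse $P^{-1}$ is reduction mod 1. Set $$D_\ast^N=P\,\mathbb{T}_\ast^N=\{u\in\mathbb{R}^{N-1}\times[0,1): u_i-u_j\in\mathbb{R}\setminus\mathbb{Z}\ \forall i\ne j\in[1,N],\ 0<u_N-u_i<1\ \forall i\in[1,N-1]\},$$ $$I_N=\{u\in\mathbb{R}^{N-1}\times[0,1): u_1<u_2<\cdots<u_{N-1}<u_N<u_1+1\}\subset D_\ast^N.$$ For $u\in D_\ast^N$, $\pi_u$ is the unique element of $\Pi_{N-1}$ with $\pi_u u\in I_N$. The map $\mathcal{F}$ takes values in $I_N$ and is defined up to a set of zero Lebesgue measure in $I_N$. A set $A$ is forward invariant for a map $T$ if it is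 a nonempty subset of the domain of $T$ with $T(A)\subset A$. Let $M$ be $\mathbb{T}^N$, $D_\ast^N$ or $I_N$. A map $T$ of $M$ (possibly defined only up to a null set) is piecewise affine if there is a finite collection $\{A_\omega\}$ of open, convex, pairwise disjoint polytopes included in $M$ (an atomic collection) such that $M\setminus\bigcup_\omega A_\omega$ has zero Lebesgue measure and, for each $\omega$, $T|_{A_\omega}$ is affine with $T(A_\omega)\subset M$. Atomic collections are not unique. A finite (nonempty) union $\bigcup_k U_k$ of polytopes with nonempty interior in $M$ is an invariant union of polytopes (IUP) for $T$ if there is an atomic collection $\{A_\omega\}$ of $T$ with $T\left(\bigcup_{k,\omega}U_k\cap A_\omega\right)\subset\bigcup_k U_k$. *)

(* Defs.v *)
From HB Require Import structures.
From mathcomp Require Import all_boot all_order all_algebra perm.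
From mathcomp Require Import ring.
From mathcomp Require Import all_classical all_reals all_analysis.
Set Implicit Arguments. Unset Strict Implicit. Unset Printing Implicit Defensive.
Import Order.TTheory GRing.Theory Num.Theory numFieldNormedType.Exports.
Local Open Scope classical_set_scope.
Local Open Scope ring_scope.
Local Open Scope quotient_scope.

(* Throughout N = n.+1; the coordinates 1, ..., N are indexed by 'I_n.+1, so
   that the distinguished last coordinate u_N is [u 0 ord_max]. *)

Section Spaces.
Variable R : realType.

Definition integers : zmodClosed R :=
  GRing.ZmodClosed.clone R (@Num.int_num_subdef R) _.

Definition circle := Quotient.quot integers.

Variable n : nat.
Local Notation V := 'rV[R]_n.+1.

Definition mod1 (x : V) : 'rV[circle]_n.+1 := map_mx (\pi_circle) x.

End Spaces.

Notation torus R n := 'rV[circle R]_n.+1.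

Section LebesgueNull.
Variables (R : realType) (n : nat).
Local Notation V := 'rV[R]_n.+1.

Definition box (c : V * V) : set V :=
  [set x | forall i, c.1 0 i <= x 0 i <= c.2 0 i].

Definition box_vol (c : V * V) : R := \prod_i (c.2 0 i - c.1 0 i).

Definition box_cover (A : set V) : set (nat -> V * V) :=
  [set c : nat -> V * V |
     (forall k i, (c k).1 0 i <= (c k).2 0 i) /\ A `<=` \bigcup_k box (c k)].

(* N-dimensional Lebesgue outer measure; "zero Lebesgue measure" below means
   that it vanishes. *)
Definition lebesgue_outer (A : set V) : \bar R :=
  ereal_inf ((fun c : nat -> V * V => \sum_(0 <= k <oo) (box_vol (c k))%:E)%E
             @` box_cover A).

End LebesgueNull.

(* The notions below are shared by R^N and T^N.  They are stated for a space X
   with a parametrization [p : R^N -> X], which is the identity when X = R^N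
   and reduction mod 1 when X = T^N. *)

Section PiecewiseAffine.
Variables (R : realType) (n : nat) (X : Type) (p : 'rV[R]_n.+1 -> X).
Local Notation V := 'rV[R]_n.+1.

(* For X = T^N, a set has zero Lebesgue measure iff its Z^N-periodic lift to R^N
   has. *)
Definition null_set (A : set X) : Prop := lebesgue_outer (p @^-1` A) = 0%E.

(* A partial map of X is a total function T together with its domain [dom]. *)
Definition nonsingular (dom : set X) (T : X -> X) : Prop :=
  forall E : set X, null_set E -> null_set (dom `&` T @^-1` E).

(* A polytope of R^N is a bounded finite intersection of half-spaces (hence
   convex), each of which may be open or closed: [x < y ?<= if c] is [x <= y]
   or [x < y] according to c. *)
Definition polytope (B : set V) : Prop :=
  bounded_set B /\
  exists (m : nat) (a : 'I_m -> 'cV[R]_n.+1) (b : 'I_m -> R) (c : 'I_m -> bool),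
    B = [set x | forall j, (x *m a j) 0 0 < b j ?<= if c j].

(* A polytope of T^N is an injective image of a polytope of R^N. *)
Definition polytope_lift (B : set V) (A : set X) : Prop :=
  [/\ polytope B, set_inj B p & A = p @` B].

(* Affinity of T on p(B), read in the chart given by the lift B; the values of a
   map of T^N are affine modulo 1. *)
Definition affine_on (B : set V) (T : X -> X) : Prop :=
  exists (L : 'M[R]_n.+1) (b : V), forall x, B x -> T (p x) = p (x *m L + b).

Definition atomic_collection (M dom : set X) (T : X -> X)
    (m : nat) (A : 'I_m -> set X) : Prop :=
  [/\ forall w, exists B, [/\ polytope_lift B (A w), open B & affine_on B T],
      forall w, A w `<=` M `&` dom,
      trivIset setT A,
      null_set (M `\` \bigcup_w A w) &
      forall w, T @` A w `<=` M].

Definition piecewise_affine (M dom : set X) (T : X -> X) : Prop :=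
  exists (m : nat) (A : 'I_m -> set X), atomic_collection M dom T A.

Definition is_IUP (M dom : set X) (T : X -> X) (U : set X) : Prop :=
  exists (K : nat) (W : 'I_K.+1 -> set X),
    [/\ forall k, W k `<=` M /\ exists2 B, polytope_lift B (W k) & B° !=set0,
        U = \bigcup_k W k &
        exists (m : nat) (A : 'I_m -> set X), atomic_collection M dom T A /\
          T @` (\bigcup_k \bigcup_w (W k `&` A w)) `<=` U].

End PiecewiseAffine.

Definition forward_invariant (X : Type) (dom : set X) (T : X -> X)
    (A : set X) : Prop :=
  [/\ A !=set0, A `<=` dom & T @` A `<=` A].

Definition two_disjoint (X : Type) (Q : set X -> Prop) (S : set X) : Prop :=
  exists A B : set X, [/\ Q A, Q B, A `<=` S, B `<=` S & A `&` B = set0].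

Section Projection.
Variables (R : realType) (n : nat).
Local Notation V := 'rV[R]_n.+1.
Local Notation T := (torus R n).

Definition last_fixing : set 'S_n.+1 := [set s | s ord_max = ord_max].

(* The action of a permutation s is [col_perm s], (s u)_i = u_(s i), both on
   R^N and on T^N. *)

Definition tstar : set T := [set u | forall i j, i != j -> u 0 i != u 0 j].

Definition Preal (x : V) : V :=
  \row_i (x 0 i + (Num.floor (x 0 ord_max - x 0 i))%:~R
                - (Num.floor (x 0 ord_max))%:~R).

Definition P (u : T) : V := Preal (map_mx repr u).

Lemma Preal_shift (x : V) (z : 'I_n.+1 -> int) :
  Preal (\row_i (x 0 i + (z i)%:~R)) = Preal x.
Proof.
apply/rowP => i; rewrite !mxE.
have -> : x 0 ord_max + (z ord_max)%:~R - (x 0 i + (z i)%:~R) =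
          x 0 ord_max - x 0 i + (z ord_max - z i)%:~R.
  by rewrite intrB opprD addrACA.
rewrite !(floorDrz _ (intr_int _ _)) !intrKfloor !intrD rmorphN/=.
ring.
Qed.

(* P may be computed with any real representatives. *)
Lemma P_mod1 (x : V) : P (mod1 x) = Preal x.
Proof.
pose z i := Num.floor (repr (\pi_(circle R) (x 0 i)) - x 0 i).
rewrite -(Preal_shift x z) /P; congr Preal; apply/rowP => i; rewrite !mxE.
rewrite /z floorK; first by rewrite addrC subrK.
have /eqP : \pi_(circle R) (repr (\pi_(circle R) (x 0 i))) =
            \pi_(circle R) (x 0 i) by rewrite reprK.
by rewrite -Quotient.idealrBE.
Qed.

Lemma mod1_P (u : T) : mod1 (P u) = u.
Proof.
have int0 (z : int) (y : R) : \pi_(circle R) (y + z%:~R) = \pi_(circle R) y.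
  apply/eqP; rewrite -Quotient.idealrBE addrC addKr.
  exact: (intr_int R z).
apply/rowP => i; rewrite !mxE -addrA -rmorphN -intrD int0; exact: reprK.
Qed.

Definition Dstar : set V := P @` tstar.

Lemma DstarE : Dstar =
  [set u | [/\ 0 <= u 0 ord_max < 1,
               forall i j, i != j -> u 0 i - u 0 j \isn't a Num.int &
               forall i, i != ord_max -> 0 < u 0 ord_max - u 0 i < 1]].
Proof.
have fracP (y : R) : 0 <= y - (Num.floor y)%:~R < 1.
  by have := floor_itv y; rewrite subr_ge0 ltrBlDl intrD.
have neqP (x y : R) : (\pi_(circle R) x != \pi_(circle R) y) =
                      (x - y \isn't a Num.int).
  by rewrite -Quotient.idealrBE.
apply/seteqP; split => [_ [u tu <-]|u [u0 uI u1]].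
- have PI i j : i != j -> (P u) 0 i - (P u) 0 j \isn't a Num.int.
    by move=> /tu; rewrite -{1 2}(mod1_P u) !mxE; rewrite neqP.
  split => //.
  + by rewrite mxE subrr floor0 addr0 fracP.
  + move=> i im; have /PI : ord_max != i by rewrite eq_sym.
    set a := _ - _.
    have /andP[a0 a1] : 0 <= a < 1.
      rewrite /a !mxE subrr floor0 addr0.
      set v := repr (u 0 ord_max); set w := repr (u 0 i).
      have -> : v - (Num.floor v)%:~R
                - (w + (Num.floor (v - w))%:~R - (Num.floor v)%:~R) =
                v - w - (Num.floor (v - w))%:~R.
        by rewrite opprB addrA subrK opprD addrA.
      exact: fracP.
    rewrite a1 andbT lt_neqAle a0 andbT => aI.
    by apply: contraNneq aI => <-; exact: (intr_int R 0).
- exists (mod1 u).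
    by move=> i j ij; rewrite !mxE neqP uI.
  rewrite P_mod1; apply/rowP => i; rewrite mxE.
  have f0 (y : R) : 0 <= y < 1 -> Num.floor y = 0 by move=> ?; apply: floor_def.
  rewrite (f0 (u 0 ord_max))// subr0.
  have [->|/u1/andP[a0 a1]] := eqVneq i ord_max; first by rewrite subrr floor0 addr0.
  by rewrite f0 ?addr0// (ltW a0).
Qed.

Definition Iset : set V :=
  [set u | [/\ 0 <= u 0 ord_max < 1,
               forall i j : 'I_n.+1, (i < j)%N -> u 0 i < u 0 j &
               u 0 ord_max < u 0 0 + 1]].

Definition pi_of (u : V) : 'S_n.+1 :=
  xget 1%g (last_fixing `&` [set s | Iset (col_perm s u)]).

Variable F : T -> T.

(* The total functions Fhat and Fproj are relevant on [range P] and on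
   [Fproj_dom] only; on [range P] the inverse of P is [mod1]. *)
Definition Fhat : V -> V := P \o F \o @mod1 R n.

Definition Fproj_dom : set V := Iset `&` Fhat @^-1` Dstar.

Definition Fproj (u : V) : V := col_perm (pi_of (Fhat u)) (Fhat u).

End Projection.

(* Main.v *)
Require Import Defs.
From HB Require Import structures.
From mathcomp Require Import all_boot all_order all_algebra perm.
From mathcomp Require Import all_classical all_reals all_analysis.
From mathcomp Require Import ring lra.
Set Implicit Arguments. Unset Strict Implicit. Unset Printing Implicit Defensive.
Import Order.TTheory GRing.Theory Num.Theory numFieldNormedType.Exports.
Local Open Scope classical_set_scope.
Local Open Scope ring_scope.

(** Reduction modulo 1 and [P] identify the torus with a subset of R^N on which
    [Fhat F] acts, and [F] and [Fhat F] commute with the group of permutations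
    fixing the last coordinate. Each orbit of this group in [Dstar] meets [Iset]
    in exactly one point, the increasing rearrangement ([Dstar_sort],
    [Iset_perm_unique]), and [Fproj F] is the map that [Fhat F] induces on these
    representatives. If a set [U] included in [Iset] is invariant under
    [Fproj F], the union [symmetrization U] of its images under the group is
    therefore invariant under [Fhat F] ([symmetrization_Fhat]), and disjoint sets
    have disjoint symmetrizations ([symmetrization_disjoint]). Pulling back along [P]
    then yields invariant sets of [F]. This proves (i).

    For (ii), the inverse image of a null set under [Preal] is a countable union
    of translates of parts of it, so non-singularity passes from [F] to [Fhat F],
    and from there to [Fproj F], which coincides with one of finitely many
    permutations of [Fhat F] at each point. The main point is to cut [Dstar]
    into pieces ([Fhat_cells]). An atom of [F] is the image of an open polytope
    [B] on which [F] lifts to an affine map [g]. Almost every point of [Dstar] is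
    [y + z] with [y] in some [B] and [z] integral, and [Fhat F] maps it to [g y + k] with
    [k] integral. Since [Dstar], [B] and [g(B)] are bounded, only finitely many
    [z] and [k] occur. Fixing [B], [z], [k] and the permutations that sort the
    point and its image defines an open polytope on which [Fhat F] is affine, and
    [Fproj F] too if the piece lies in [Iset]. The points that are missed lie in null sets: those
    outside the atoms of [F], those with zero last coordinate, and those mapped
    by [Fhat F] outside [Dstar] or to zero last coordinate. The last two classes
    are null by non-singularity, because [null_graph] makes the coordinate and
    diagonal hyperplanes null.

    If [U] is an invariant union of polytopes for [Fproj F] with atoms [A w], its
    symmetrization is one for [Fhat F]: the atoms to use are the intersections of
    the pieces above with the permuted [A w], because affinity comes from the
    former and invariance from the latter ([IUP_symmetrization]). *)

(** * Null sets *)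

Section NullSets.
Variables (R : realType) (n : nat).
Local Notation V := 'rV[R]_n.+1.
Local Notation null := (@Defs.null_set R n V id).
Implicit Types (A B : set V) (c : nat -> V * V).

Lemma box_vol_ge0 (c : V * V) : (forall i, c.1 0 i <= c.2 0 i) -> 0 <= box_vol c.
Proof. by move=> h; apply: prodr_ge0 => i _; rewrite subr_ge0. Qed.

Lemma box_cover_vol_ge0 A c : box_cover A c -> forall k, (0 <= (box_vol (c k))%:E)%E.
Proof. by move=> [h _] k; rewrite lee_fin box_vol_ge0. Qed.

Lemma nullP A : null A <-> forall e : R, 0 < e ->
  exists2 c, box_cover A c & (\sum_(0 <= k <oo) (box_vol (c k))%:E <= e%:E)%E.
Proof.
split => [A0 e e0|h].
  have : (lebesgue_outer A < e%:E)%E by rewrite [lebesgue_outer A]A0 lte_fin.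
  by move=> /ereal_inf_lt[_ [c cA <-]] /ltW; exists c.
apply/eqP; rewrite eq_le; apply/andP; split; last first.
  apply: le_ereal_inf_tmp => _ [c cA <-].
  by apply: nneseries_ge0 => k _ _; exact: box_cover_vol_ge0 cA k.
apply/lee_addgt0Pr => e e0; rewrite add0e.
have [c cA ce] := h e e0.
by apply: le_trans ce; apply: ereal_inf_lbound; exists c.
Qed.

Lemma null_sub A B : A `<=` B -> null B -> null A.
Proof.
move=> AB /nullP B0; apply/nullP => e /B0[c [c1 c2] ce].
by exists c => //; split => //; exact: subset_trans c2.
Qed.

(** The [i]-th set is covered up to volume [e / 2 ^ i.+1], and the covers are
    merged along a bijection between pairs and natural numbers. *)
Lemma null_bigcup (A : nat -> set V) :
  (forall i, null (A i)) -> null (\bigcup_i A i).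
Proof.
move=> A0; apply/nullP => e e0.
have /choice[c cP] : forall i, exists c, box_cover (A i) c /\
    (\sum_(0 <= k <oo) (box_vol (c k))%:E <= (e / (2 ^ i.+1)%:R)%:E)%E.
  move=> i; have [||c ? ?] := (nullP (A i)).1 _ (e / (2 ^ i.+1)%:R).
  - exact: A0.
  - by rewrite divr_gt0// ltr0n expn_gt0.
  - by exists c.
have /card_esym/ppcard_eqP[f] := card_nat2.
have c0 i k : (0 <= (box_vol (c i k))%:E)%E by exact: box_cover_vol_ge0 (cP i).1 k.
exists (fun k => c (f k).1 (f k).2).
  split=> [k j|x [i _ /(cP i).1.2[k _ xk]]]; first exact: (cP (f k).1).1.1.
  by exists (f^-1%FUN (i, k)) => //=; rewrite invK ?inE.
rewrite nneseries_esumT// -(@reindex_esum _ _ _ setT setT f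
  (fun p => (box_vol (c p.1 p.2))%:E)); last exact: 'bij_f.
rewrite (_ : setT = setT `*`` (fun=> setT)); last exact/seteqP.
rewrite -(@esum_esum _ _ _ setT (fun=> setT) (fun i k => (box_vol (c i k))%:E))//.
rewrite -nneseries_esumT => [|i]; last exact: esum_ge0.
apply: le_trans (epsilon_trick0 _ (ltW e0)).
apply: lee_nneseries => [i _ _|i _]; first exact: esum_ge0.
by rewrite -nneseries_esumT//; exact: (cP i).2.
Qed.

Lemma null0 : null set0.
Proof.
apply/nullP => e e0; exists (fun=> (0, 0)); first by split.
rewrite eseries0 ?lee_fin ?(ltW e0)// => k _ _.
by rewrite /box_vol (bigD1 ord0)//= subrr mul0r.
Qed.

Lemma null_bigcup_count (I : countType) (A : I -> set V) :
  (forall i, null (A i)) -> null (\bigcup_i A i).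
Proof.
move=> A0; pose B k := if unpickle k is Some i then A i else set0.
apply: (@null_sub _ (\bigcup_k B k)) => [x [i _ xi]|].
  by exists (pickle i) => //; rewrite /B pickleK.
by apply: null_bigcup => k; rewrite /B; case: unpickle => [i|]; [exact: A0|exact: null0].
Qed.

Lemma nullU A B : null A -> null B -> null (A `|` B).
Proof.
move=> A0 B0; rewrite -bigcup2E; apply: null_bigcup => -[|[|k]] //=; exact: null0.
Qed.

(** Reindexing the coordinates and translating map boxes to boxes of the same
    volume, so they preserve null sets. *)
Lemma null_preimage_translate_perm (s : 'S_n.+1) (v : V) A :
  null A -> null ((fun x => col_perm s x + v) @^-1` A).
Proof.
move=> /nullP A0; apply/nullP => e /A0[c [c1 c2] ce].
pose g (y : V) : V := col_perm s^-1%g (y - v).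
exists (fun k => (g (c k).1, g (c k).2)).
  split=> [k i|x /= /c2[k _ xk]] /=; first by rewrite !mxE lerD2r.
  exists k => // i; have := xk (s^-1%g i).
  by rewrite !mxE permKV lerBlDr lerBrDr.
rewrite (@eq_eseriesr _ _ (fun k => (box_vol (c k))%:E))// => k _.
congr EFin; rewrite /box_vol /= [RHS](reindex_inj (@perm_inj _ s^-1%g)).
by apply: eq_bigr => i _; rewrite !mxE opprB addrA subrK.
Qed.

Lemma null_preimage_perm (s : 'S_n.+1) A : null A -> null (col_perm s @^-1` A).
Proof.
move=> /(null_preimage_translate_perm s 0); apply: null_sub => x /=.
by rewrite addr0.
Qed.

Lemma null_preimage_translate (v : V) A : null A -> null ((fun x => x + v) @^-1` A).
Proof.
move=> /(null_preimage_translate_perm 1%g v); apply: null_sub => x /=.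
by rewrite col_perm1.
Qed.

Lemma null_finite_cover A :
  (forall e : R, 0 < e -> exists (K : nat) c,
     [/\ forall k i, (c k).1 0 i <= (c k).2 0 i,
         A `<=` \bigcup_(k in `I_K) box (c k) &
         \sum_(0 <= k < K) box_vol (c k) <= e]) -> null A.
Proof.
move=> h; apply/nullP => e /h[K [c [c1 c2 ce]]].
(* The cover is padded with one-point boxes, which have volume 0 because the
   dimension is positive. *)
pose d k := if (k < K)%N then c k else (0, 0).
exists d.
  split=> [k i|x /c2[k /= kK xk]]; first by rewrite /d; case: ifP => // _; exact: c1.
  by exists k => //; rewrite /d kK.
rewrite (@lim_near_cst _ _ _ _ _ (\sum_(0 <= k < K) (box_vol (c k))%:E)%E)//.
  by rewrite sumEFin lee_fin.
near=> N; have KN : (K <= N)%N by near: N; exact: nbhs_infty_ge.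
rewrite (@big_cat_nat _ _ _ K)//= [X in (_ + X)%E]big1_seq ?adde0.
  by apply: eq_big_nat => k /andP[_ kK]; rewrite /d kK.
move=> k; rewrite mem_index_iota => /andP[_ /andP[Kk _]].
by rewrite /d ltnNge Kk /box_vol (bigD1 ord0)//= subrr mul0r.
Unshelve. all: by end_near. Qed.

(** Over the cube [-m, m]^N, the part of the graph where [x 0 j] ranges over an
    interval of length [d] lies in a box of width [d] in direction [j] and, [f]
    being nonexpansive, of width [2 * d] in direction [i]. About [2 * m / d] such
    boxes cover it, so that their total volume is of order [d]. *)
Lemma null_graph (i j : 'I_n.+1) (f : R -> R) : i != j ->
  (forall a b, `|f a - f b| <= `|a - b|) -> null [set x | x 0 i = f (x 0 j)].
Proof.
move=> ij f1.
pose G (m : nat) := [set x : V | x 0 i = f (x 0 j) /\ forall t, `|x 0 t| <= m%:R].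
apply: (@null_sub _ (\bigcup_m G m)) => [x /= xij|].
  have [m mP] : exists m : nat, forall t, `|x 0 t| <= m%:R.
    exists (\max_(t < n.+1) (Num.trunc `|x 0%R t|%R).+1)%N => t.
    apply: (@le_trans _ _ (Num.trunc `|x 0 t|).+1%:R).
      by have /andP[_ /ltW] := truncn_itv (normr_ge0 (x 0 t)).
    by rewrite ler_nat (leq_bigmax (F := fun t => (Num.trunc `|x 0 t|).+1) t).
  by exists m.
apply: null_bigcup => m; apply: null_finite_cover => e e0.
(* [B / M.+1] is the total volume of the boxes of width [1 / M.+1]. *)
pose C : R := \prod_(t < n.+1 | (t != j) && (t != i)) (m%:R - (- m%:R)).
have C0 : 0 <= C by apply: prodr_ge0 => t _; rewrite opprK addr_ge0.
pose B : R := ((2 * m).+1)%:R * (2 * C).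
have B0 : 0 <= B by rewrite !mulr_ge0.
have [M MP] : exists M : nat, B <= e * M.+1%:R.
  exists (Num.trunc (B / e)); rewrite mulrC -ler_pdivrMr//.
  by have /andP[_ /ltW] := truncn_itv (divr_ge0 B0 (ltW e0)).
pose d : R := M.+1%:R^-1.
have d0 : 0 < d by rewrite invr_gt0.
pose l k : R := - m%:R + k%:R * d.
pose lo k : V := \row_t (if t == j then l k else
                         if t == i then f (l k) - d else - m%:R).
pose hi k : V := \row_t (if t == j then l k + d else
                         if t == i then f (l k) + d else m%:R).
exists ((2 * m).+1 * M.+1)%N, (fun k => (lo k, hi k)); split.
- move=> k t; rewrite !mxE; case: ifP => _; first by rewrite lerDl ltW.
  by case: ifP => _; [lra|rewrite (le_trans (y := 0))// oppr_le0].
- move=> x [xij xm].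
  have /andP[xj1 xj2] : - m%:R <= x 0 j <= m%:R by rewrite -ler_norml.
  have y0 : 0 <= (x 0 j + m%:R) * M.+1%:R by rewrite mulr_ge0//; lra.
  have /andP[k1 k2] := truncn_itv y0; set k := Num.trunc _ in k1 k2.
  have kd1 : k%:R * d <= x 0 j + m%:R by rewrite /d ler_pdivrMr.
  have kd2 : x 0 j + m%:R <= k%:R * d + d.
    by rewrite -[X in _ <= _ + X]mul1r -mulrDl natr1 /d ler_pdivlMr// ltW.
  have lk1 : l k <= x 0 j by rewrite /l; lra.
  have lk2 : x 0 j <= l k + d by rewrite /l; lra.
  exists k => [/=|t].
    rewrite truncn_lt_nat// natrM ltr_pM2r// -natr1 natrM; lra.
  rewrite /= !mxE; case: eqP => [->|_]; first by rewrite lk1.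
  case: eqP => [->|_]; last by rewrite -ler_norml.
  rewrite -ler_distl xij; apply: le_trans (f1 _ _) _.
  by rewrite ger0_norm ?subr_ge0// lerBlDl.
- rewrite (eq_bigr (fun=> d * (2 * d * C))); last first.
    move=> k _; rewrite /box_vol (bigD1 j)//= (bigD1 i)//= !mxE eqxx (negbTE ij) eqxx.
    congr (_ * (_ * _)); [ring|ring|].
    by apply: eq_bigr => t /andP[/negbTE tj /negbTE ti]; rewrite !mxE tj ti.
  rewrite sumr_const_nat subn0 -[X in X <= _]mulr_natl natrM.
  rewrite (_ : _ * _ = B * d); last first.
    by rewrite /B /d; field; rewrite nat1r pnatr_eq0.
  by rewrite /d ler_pdivrMr.
Qed.

End NullSets.

(** * Polyhedra and affine maps *)

Section Polyhedra.
Variables (R : realType) (n : nat).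
Local Notation V := 'rV[R]_n.+1.
Implicit Types (B : set V) (g : V -> V).

(** Polytopes without the boundedness condition, which is not stable under affine
    preimages; all the sets that matter lie in the bounded set [Dstar]. *)
Definition polyhedron B := exists (m : nat) (a : 'I_m -> 'cV[R]_n.+1)
    (b : 'I_m -> R) (c : 'I_m -> bool),
  B = [set x | forall j, (x *m a j) 0 0 < b j ?<= if c j].

Lemma polyhedron_finType (J : finType) (a : J -> 'cV[R]_n.+1) (b : J -> R) (c : J -> bool) :
  polyhedron [set x | forall j, (x *m a j) 0 0 < b j ?<= if c j].
Proof.
exists #|J|, (a \o enum_val), (b \o enum_val), (c \o enum_val).
apply/seteqP; split => [x h j|x h j] /=; first exact: h.
by have := h (enum_rank j); rewrite /= enum_rankK.
Qed.

Lemma polyhedron_forall (J : finType) (B : J -> set V) :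
  (forall j, polyhedron (B j)) -> polyhedron [set x | forall j, B j x].
Proof.
move=> hB.
(* The number of half-spaces depends on [j], hence a choice of dependent pairs. *)
have /choice[d dP] : forall j,
    exists d : {m : nat & 'I_m -> 'cV[R]_n.+1 * R * bool},
    B j = [set x | forall i, (x *m (tagged d i).1.1) 0 0 < (tagged d i).1.2
                             ?<= if (tagged d i).2].
  move=> j; have [m [a [b [c ->]]]] := hB j.
  by exists (existT _ m (fun i => (a i, b i, c i))).
pose D (p : {j : J & 'I_(tag (d j))}) := tagged (d (tag p)) (tagged p).
have := polyhedron_finType (fun p => (D p).1.1) (fun p => (D p).1.2) (fun p => (D p).2).
congr polyhedron; apply/seteqP; split => [x h j|x h [j i]] /=.
  by rewrite dP => i; exact: h (Tagged (fun j => 'I_(tag (d j))) i).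
by have := h j; rewrite dP; exact.
Qed.

Lemma polyhedronI B C : polyhedron B -> polyhedron C -> polyhedron (B `&` C).
Proof.
move=> hB hC; have := @polyhedron_forall bool (fun i => if i then B else C).
rewrite (_ : [set x | _] = B `&` C); first by apply; case.
by apply/seteqP; split => [x h|x [Bx Cx] []]//; split; [exact: h true|exact: h false].
Qed.

Definition affine_map g := exists (L : 'M[R]_n.+1) (b : V), forall x, g x = x *m L + b.

Lemma affine_comp g h : affine_map g -> affine_map h -> affine_map (g \o h).
Proof.
move=> [L [b gE]] [M [c hE]]; exists (M *m L), (c *m L + b) => x.
by rewrite /= hE gE mulmxDl mulmxA addrA.
Qed.

Lemma affine_translate (v : V) : affine_map (fun x => x + v).
Proof. by exists 1%:M, v => x; rewrite mulmx1. Qed.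

Lemma affine_perm (s : 'S_n.+1) : affine_map (col_perm s).
Proof. by exists (perm_mx s^-1), 0 => x; rewrite col_permE addr0. Qed.

Lemma polyhedron_preimage g B : affine_map g -> polyhedron B -> polyhedron (g @^-1` B).
Proof.
move=> [L [v gE]] [m [a [b [c ->]]]].
exists m, (fun j => L *m a j), (fun j => b j - (v *m a j) 0 0), c.
have gaE x j : (g x *m a j) 0 0 = (x *m (L *m a j)) 0 0 + (v *m a j) 0 0.
  by rewrite gE mulmxDl mulmxA mxE.
by apply/seteqP; split => x /= h j; have := h j; rewrite gaE lteifBrDr.
Qed.

Lemma mulmx_continuous (p : nat) (L : 'M[R]_(n.+1, p.+1)) :
  continuous (fun x : V => x *m L).
Proof.
move=> x; rewrite (_ : (fun _ => _) = fun x : V => \sum_i x 0 i *: row i L); last first.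
  by apply/funext => y; exact: mulmx_sum_row.
rewrite /continuous_at.
apply: (@cvg_big _ _ +%R 0 xpredT (@add_continuous _) _ (nbhs x) _ _ _
  (nbhs_filter x)) => i _.
apply: cvgZr_tmp; exact: coord_continuous.
Qed.

Lemma affine_continuous g : affine_map g -> continuous g.
Proof.
move=> [L [b gE]] x; rewrite (_ : g = fun x => x *m L + b); last exact/funext.
apply: cvgD; [exact: (nbhs_filter x)|exact: mulmx_continuous|].
by apply: cvg_cst; exact: (nbhs_filter x).
Qed.

Definition open_polyhedron B := polyhedron B /\ open B.

Lemma open_polyhedron_preimage g B : affine_map g ->
  open_polyhedron B -> open_polyhedron (g @^-1` B).
Proof.
move=> ga [Bp Bo]; split; first exact: polyhedron_preimage.
by apply: open_comp => // x _; exact: affine_continuous.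
Qed.

Lemma open_polyhedron_forall (J : finType) (B : J -> set V) :
  (forall j, open_polyhedron (B j)) -> open_polyhedron [set x | forall j, B j x].
Proof.
move=> hB; split; first by apply: polyhedron_forall => j; exact: (hB j).1.
rewrite openE => x Bx; apply: (filter_forall (nbhs_filter x)) => j.
by apply: open_nbhs_nbhs; split; [exact: (hB j).2|exact: Bx].
Qed.

Lemma open_polyhedronI B C :
  open_polyhedron B -> open_polyhedron C -> open_polyhedron (B `&` C).
Proof.
by move=> [Bp Bo] [Cp Co]; split; [exact: polyhedronI|exact: openI].
Qed.

Lemma open_polyhedron_halfspace (a : 'cV[R]_n.+1) (b : R) :
  open_polyhedron [set x | (x *m a) 0 0 < b].
Proof.
split.
  have := polyhedron_finType (fun _ : unit => a) (fun=> b) (fun=> false).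
  by congr polyhedron; apply/seteqP; split => [x /(_ tt)|x h []].
apply: (@open_comp _ _ (fun x : V => (x *m a) 0 0) [set y | y < b] ); last exact: open_lt.
move=> x _; apply: (@continuous_comp _ _ _ (fun x : V => x *m a) (fun y : 'M[R]_(1, 1) => y 0 0)).
  exact: mulmx_continuous.
exact: coord_continuous.
Qed.

Lemma open_polyhedronT : open_polyhedron setT.
Proof.
have := open_polyhedron_halfspace 0 1.
by congr open_polyhedron; apply/seteqP; split=> // x _; rewrite /= mulmx0 mxE ltr01.
Qed.

Lemma open_polyhedron_lt (i j : 'I_n.+1) (b : R) :
  open_polyhedron [set x : V | x 0 i < x 0 j + b].
Proof.
have := open_polyhedron_halfspace (delta_mx i 0 - delta_mx j 0) b.
congr open_polyhedron; apply/funext => x /=.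
by rewrite mulmxBr -!colE !mxE ltrBlDl.
Qed.

Lemma open_polyhedron_gtc (i : 'I_n.+1) (b : R) :
  open_polyhedron [set x : V | b < x 0 i].
Proof.
have := open_polyhedron_halfspace (- delta_mx i 0) (- b).
congr open_polyhedron; apply/funext => x /=.
by rewrite mulmxN -!colE !mxE ltrN2.
Qed.

Lemma open_polyhedron_ltc (i : 'I_n.+1) (b : R) :
  open_polyhedron [set x : V | x 0 i < b].
Proof.
have := open_polyhedron_halfspace (delta_mx i 0) b.
by congr open_polyhedron; apply/funext => x /=; rewrite -!colE !mxE.
Qed.

Definition coord_bounded B (m : nat) := forall x, B x -> forall i, `|x 0 i| <= m%:R.

Lemma coord_bounded_set B m : coord_bounded B m -> bounded_set B.
Proof.
move=> h; exists m%:R; split; first exact: num_real.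
move=> M mM x Bx /=; apply: le_trans (ltW mM).
rewrite [`|x|]mx_normrE; apply: bigmax_le => // -[i j] _ /=.
by rewrite (ord1 i); exact: h.
Qed.

Lemma bounded_set_coord B : bounded_set B -> exists m, coord_bounded B m.
Proof.
move=> [M [_ MB]]; exists (Num.trunc (M + 1)).+1 => x Bx i.
have M1 : M < (Num.trunc (M + 1)).+1%:R.
  by rewrite (lt_trans (y := M + 1)) ?ltrDl// truncnS_gt.
apply: le_trans (MB _ M1 x Bx).
by rewrite [`|x|]mx_normrE (le_bigmax _ (fun i => `|x i.1 i.2|) (0, i)).
Qed.

Lemma coord_bounded_affine g B m : affine_map g -> coord_bounded B m ->
  exists m', coord_bounded (g @` B) m'.
Proof.
move=> [L [b gE]] Bm.
pose C i : R := \sum_k m%:R * `|L k i| + `|b 0 i|.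
exists (\max_i (Num.trunc (C i)).+1)%N => _ [x Bx <-] i.
apply: (@le_trans _ _ (Num.trunc (C i)).+1%:R); last first.
  by rewrite ler_nat (leq_bigmax (F := fun i => (Num.trunc (C i)).+1) i).
apply: (@le_trans _ _ (C i)); last by rewrite ltW// truncnS_gt.
rewrite gE !mxE (le_trans (ler_normD _ _))// lerD2r.
apply: le_trans (ler_norm_sum _ _ _) _; apply: ler_sum => k _.
by rewrite normrM ler_wpM2r// Bm.
Qed.

End Polyhedra.

(** * The fundamental domains of the torus and of the permutations *)

Section FundamentalDomains.
Variables (R : realType) (n : nat).
Local Notation V := 'rV[R]_n.+1.
Local Notation T := (torus R n).
Local Notation I := (@Iset R n).
Local Notation D := (@Dstar R n).
Implicit Types (u x : V) (s t : 'S_n.+1) (z : 'rV[int]_n.+1).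

Local Notation intv z := (map_mx (fun k : int => k%:~R : R) z).

Lemma last_fixingV s : last_fixing s -> last_fixing s^-1%g.
Proof. by rewrite /last_fixing /= => {1}<-; rewrite permK. Qed.

Lemma last_fixingM s t : last_fixing s -> last_fixing t -> last_fixing (s * t)%g.
Proof. by rewrite /last_fixing /= permM => -> ->. Qed.

Lemma mod1_perm s x : mod1 (col_perm s x) = col_perm s (mod1 x).
Proof. by apply/rowP => i; rewrite !mxE. Qed.

Lemma Preal_perm s x : last_fixing s -> Preal (col_perm s x) = col_perm s (Preal x).
Proof. by move=> sl; apply/rowP => i; rewrite !mxE sl. Qed.

Lemma P_perm s (t : T) : last_fixing s -> P (col_perm s t) = col_perm s (P t).
Proof. by move=> sl; rewrite -Preal_perm//; congr Preal; apply/rowP => i; rewrite !mxE. Qed.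

Lemma Preal_intv x : exists z, Preal x = x + intv z.
Proof.
exists (\row_i (Num.floor (x 0 ord_max - x 0 i) - Num.floor (x 0 ord_max))).
by apply/rowP => i; rewrite !mxE intrB addrA.
Qed.

Lemma Preal_translate x z : Preal (x + intv z) = Preal x.
Proof.
rewrite -[RHS](Preal_shift x (fun i => z 0 i)); congr Preal.
by apply/rowP => i; rewrite !mxE.
Qed.

Lemma mod1_Preal x : mod1 (Preal x) = mod1 x.
Proof. by rewrite -P_mod1 mod1_P. Qed.

Lemma mod1_translate x z : mod1 (x + intv z) = mod1 x.
Proof. by rewrite -mod1_Preal Preal_translate mod1_Preal. Qed.

Lemma mod1_untranslate x z : mod1 (x - intv z) = mod1 x.
Proof. by rewrite -(mod1_translate _ z) subrK. Qed.

Lemma mod1_eq x y : mod1 x = mod1 y -> exists z, x = y + intv z.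
Proof.
move=> /(congr1 (@P R n)); rewrite !P_mod1.
have [z1 ->] := Preal_intv x; have [z2 ->] := Preal_intv y => e.
exists (z2 - z1); apply/rowP => i; have /rowP/(_ i) := e; rewrite !mxE intrB => {}e.
by rewrite addrA -e addrK.
Qed.

Lemma intv_inj : injective (fun z => intv z : V).
Proof. by move=> z1 z2 /rowP e; apply/rowP => i; have := e i; rewrite !mxE => /intr_inj. Qed.

Lemma Dstar_range : D `<=` range (@P R n).
Proof. by move=> _ [t _ <-]; exists t. Qed.

Lemma Preal_id u : range (@P R n) u -> Preal u = u.
Proof. by move=> [t _ <-]; rewrite -P_mod1 mod1_P. Qed.

Lemma Dstar_Preal u : D u -> Preal u = u.
Proof. by move=> /Dstar_range/Preal_id. Qed.

Lemma P_Dstar (t : T) : D (P t) <-> tstar t.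
Proof.
split=> [[t' ? e]|]; last by exists t.
by rewrite -(mod1_P t) -e mod1_P.
Qed.

Lemma tstar_perm s (t : T) : tstar t -> tstar (col_perm s t).
Proof. by move=> h i j ij; rewrite !mxE h// (inj_eq perm_inj). Qed.

Lemma Dstar_perm s u : last_fixing s -> D u -> D (col_perm s u).
Proof.
by move=> sl [t tt <-]; rewrite -P_perm//; exists (col_perm s t) => //; exact: tstar_perm.
Qed.

Lemma col_permK s : cancel (@col_perm R 1 n.+1 s) (col_perm s^-1%g).
Proof. by move=> u; rewrite -col_permM mulVg col_perm1. Qed.

Lemma col_permKV s : cancel (@col_perm R 1 n.+1 s^-1%g) (col_perm s).
Proof. by move=> u; rewrite -col_permM mulgV col_perm1. Qed.

Lemma Dstar_permE s u : last_fixing s -> D (col_perm s u) -> D u.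
Proof. by move=> /last_fixingV sl /(Dstar_perm sl); rewrite col_permK. Qed.

Lemma Iset_Dstar : I `<=` D.
Proof.
move=> u [u0 um u1]; rewrite DstarE.
have ule (i : 'I_n.+1) : u 0 i <= u 0 ord_max.
  have [->//|im] := eqVneq i ord_max.
  by apply/ltW/um; rewrite ltn_neqAle im -ltnS /=.
have uge (i : 'I_n.+1) : u 0 0 <= u 0 i.
  by have [->//|i0] := eqVneq i 0; apply/ltW/um; rewrite lt0n.
have uI (i j : 'I_n.+1) : (i < j)%N -> 0 < u 0 j - u 0 i < 1.
  move=> /um ij; rewrite subr_gt0 ij /=; have := ule j; have := uge i; lra.
have int01 (y : R) : 0 < y < 1 -> y \isn't a Num.int.
  move=> /andP[y0 y1]; apply/negP => /intrP[k ky]; move: y0 y1.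
  by rewrite ky ltr0z ltrz1; case: k {ky} => // -[].
split=> [//|i j ij|i im]; last by apply: uI; rewrite ltn_neqAle im -ltnS /=.
have [/uI/int01|/uI/int01//|/val_inj e] := ltngtP i j.
- by rewrite -opprB rpredN.
- by rewrite e eqxx in ij.
Qed.

Lemma Iset_sorted u : I u -> sorted <%R [seq u 0 i | i <- enum 'I_n.+1].
Proof.
move=> [_ um _]; apply/(sortedP 0) => i; rewrite size_map size_enum_ord => ilt.
rewrite !(nth_map ord0) -?enumT ?size_enum_ord ?(ltnW ilt)//.
by apply: um; rewrite !nth_enum_ord ?(ltnW ilt).
Qed.

(** Both rearrangements list the same values in increasing order. *)
Lemma Iset_perm_unique s t u : I (col_perm s u) -> I (col_perm t u) -> s = t.
Proof.
move=> Is It.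
have e : [seq col_perm s u 0 i | i <- enum 'I_n.+1] =
         [seq col_perm t u 0 i | i <- enum 'I_n.+1].
  apply: lt_sorted_eq; [exact: Iset_sorted..|].
  have memE r y : (y \in [seq col_perm r u 0 i | i <- enum 'I_n.+1]) =
                  (y \in [seq u 0 i | i <- enum 'I_n.+1]).
    apply/mapP/mapP => -[i _ ->].
      by exists (r i); rewrite ?mem_enum// mxE.
    by exists (r^-1%g i); rewrite ?mem_enum// mxE permKV.
  by move=> y; rewrite !memE.
apply/permP => i.
have /eqP : u 0 (s i) = u 0 (t i).
  have := congr1 (fun w => nth 0 w i) e.
  by rewrite !(nth_map ord0) -?enumT ?size_enum_ord// !nth_ord_enum !mxE => ->.
have [_ um _] := Is; case: (eqVneq (s i) (t i)) => // st.
have ij : i != s^-1%g (t i) by apply: contraNneq st => {1}->; rewrite permKV.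
have := um i (s^-1%g (t i)); have := um (s^-1%g (t i)) i; rewrite !mxE permKV.
by move: ij; rewrite -val_eqE /= neq_ltn => /orP[h _ /(_ h)|h /(_ h)]; case: ltgtP.
Qed.

(** In [D] the last coordinate is strictly the largest, so sorting fixes it. *)
Lemma Dstar_sort u : D u -> exists2 s, last_fixing s & I (col_perm s u).
Proof.
rewrite DstarE => -[u0 uI u1].
pose r := sort (relpre (u 0) <=%R) (enum 'I_n.+1).
have rS : size r = n.+1 by rewrite size_sort size_enum_ord.
have fI : injective (fun i : 'I_n.+1 => nth ord0 r i).
  move=> i j /eqP; rewrite nth_uniq ?rS// ?sort_uniq ?enum_uniq// => /eqP.
  exact: val_inj.
pose s := perm fI.
have us (i j : 'I_n.+1) : (i < j)%N -> u 0 (s i) < u 0 (s j).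
  move=> ij; rewrite lt_neqAle; apply/andP; split.
    have /uI : s i != s j by rewrite (inj_eq perm_inj) -val_eqE /= ltn_eqF.
    by apply: contraNneq => ->; rewrite subrr.
  rewrite !permE; have tot : total (relpre (u 0) <=%R) by move=> a b; exact: le_total.
  have tr : transitive (relpre (u 0) <=%R) by move=> a b c; exact: le_trans.
  have re : reflexive (relpre (u 0) <=%R) by move=> a; exact: lexx.
  by have := sorted_leq_nth tr re ord0 (sort_sorted tot (enum 'I_n.+1));
    apply; rewrite ?inE ?size_sort ?size_enum_ord ?ltn_ord// ltnW.
have sl : last_fixing s.
  have [e|sm] := eqVneq (s ord_max) ord_max; first exact: e.
  pose j := s^-1%g ord_max.
  have jm : (j < (ord_max : 'I_n.+1))%N.
    rewrite ltn_neqAle leq_ord andbT.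
    by apply: contraNneq sm => /val_inj jm; rewrite -{1}jm permKV.
  have := us _ _ jm; rewrite permKV => h.
  by have /andP[] := u1 _ sm; lra.
exists s => //; split; rewrite ?mxE ?sl//.
  by move=> i j ij; rewrite !mxE us.
have [->|/u1/andP[_]] := eqVneq (s 0) ord_max; lra.
Qed.

Lemma Dstar_coord_bounded : coord_bounded D 1.
Proof.
move=> u; rewrite DstarE => -[/andP[a b] _ h] i; rewrite ler_norml.
by have [->|/h/andP[]] := eqVneq i ord_max; lra.
Qed.

Lemma pi_of_last u : last_fixing (Defs.pi_of u).
Proof. by rewrite /Defs.pi_of; case: xgetP => [s _ []//|_]; rewrite /last_fixing /= perm1. Qed.

Lemma pi_of_eq u s : last_fixing s -> I (col_perm s u) -> Defs.pi_of u = s.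
Proof.
move=> sl sI; rewrite /Defs.pi_of; case: xgetP => [t _ [_ tI]|/(_ s)]; last by case.
exact: Iset_perm_unique tI sI.
Qed.

(** [I] is not open because of its face [u 0 ord_max = 0]; without this null
    face it is an open polytope. *)
Definition Iopen : set V := I `&` [set u | 0 < u 0 ord_max].

Lemma Iopen_open_polyhedron : open_polyhedron Iopen.
Proof.
have -> : Iopen = [set u : V | 0 < u 0 ord_max] `&` [set u : V | u 0 ord_max < 1] `&`
    [set u : V | forall p : 'I_n.+1 * 'I_n.+1,
       (if (p.1 < p.2)%N then [set v : V | v 0 p.1 < v 0 p.2 + 0] else setT) u] `&`
    [set u : V | u 0 ord_max < u 0 0 + 1].
  apply/seteqP; split => [u [[/andP[u0 u1] um u2] u3]|u [[[u0 u1] um] u2]].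
    by split=> //; split => // -[i j] /=; case: ifPn => //= /um; rewrite addr0.
  split=> //; split; rewrite ?u1 ?(ltW u0)// => i j ij.
  by have := um (i, j); rewrite /= ij /= addr0.
apply: open_polyhedronI; last exact: open_polyhedron_lt.
apply: open_polyhedronI.
  by apply: open_polyhedronI; [exact: open_polyhedron_gtc|exact: open_polyhedron_ltc].
apply: open_polyhedron_forall => p; case: ifP => _; last exact: open_polyhedronT.
exact: open_polyhedron_lt.
Qed.

End FundamentalDomains.

(** * Invariant sets and their symmetrizations *)

Section Symmetrization.
Variables (R : realType) (n : nat) (F : torus R n -> torus R n).
Local Notation V := 'rV[R]_n.+1.
Local Notation T := (torus R n).
Local Notation I := (@Iset R n).
Local Notation D := (@Dstar R n).
Implicit Types (u x : V) (s t : 'S_n.+1) (U : set V).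

Hypothesis F_commutes : forall s, last_fixing s ->
  forall t : T, F (col_perm s t) = col_perm s (F t).

Lemma Fhat_perm s u : last_fixing s -> Fhat F (col_perm s u) = col_perm s (Fhat F u).
Proof. by move=> sl; rewrite /Fhat /= mod1_perm F_commutes// P_perm. Qed.

Definition symmetrization U := [set u | exists2 s, last_fixing s & U (col_perm s u)].

Lemma symmetrization_Dstar U : U `<=` I -> symmetrization U `<=` D.
Proof. by move=> UI u [s sl /UI/Iset_Dstar]; exact: Dstar_permE. Qed.

(** A point is sorted by only one permutation, so it meets [U] and [U'] through
    the same one. *)
Lemma symmetrization_disjoint U U' : U `<=` I -> U' `<=` I -> U `&` U' = set0 ->
  symmetrization U `&` symmetrization U' = set0.
Proof.
move=> UI U'I UU'; rewrite -subset0 => u [[s _ Us] [t _ U't]].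
move: (U't); rewrite -(Iset_perm_unique (UI _ Us) (U'I _ U't)) => U's.
have : (U `&` U') (col_perm s u) by split.
by rewrite UU'.
Qed.

(** [Fproj F (col_perm s u)] is a permutation of [Fhat F u], because [Fhat F]
    commutes with [col_perm s]. *)
Lemma symmetrization_Fhat U s u : last_fixing s -> U (Fproj F (col_perm s u)) ->
  symmetrization U (Fhat F u).
Proof.
rewrite /Fproj => sl; set p := Defs.pi_of _; rewrite Fhat_perm// -col_permM => Up.
by exists (p * s)%g => //; apply: last_fixingM => //; exact: pi_of_last.
Qed.

Lemma symmetrization_Fhat_Dstar U : U `<=` Fproj_dom F ->
  symmetrization U `<=` Fhat F @^-1` D.
Proof.
by move=> UF u [s sl /UF[_]]; rewrite /= Fhat_perm//; exact: Dstar_permE.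
Qed.

Lemma forward_invariant_symmetrization U :
  forward_invariant (Fproj_dom F) (Fproj F) U ->
  forward_invariant (range (@P R n)) (Fhat F) (symmetrization U).
Proof.
move=> [[u Uu] UF UU]; split.
- by exists u, 1%g; rewrite ?col_perm1//= /last_fixing /= perm1.
- apply: subset_trans (@Dstar_range R n); apply: symmetrization_Dstar.
  by move=> x /UF[].
- move=> _ [x [s sl Ux] <-]; apply: (@symmetrization_Fhat _ s) => //.
  by apply: UU; exists (col_perm s x).
Qed.

Lemma forward_invariant_torus U : U `<=` D ->
  forward_invariant (range (@P R n)) (Fhat F) U ->
  forward_invariant setT F (@P R n @^-1` U).
Proof.
move=> UD [[u Uu] _ UU]; split=> [|//|_ [t Ut <-]].
  by exists (mod1 u); rewrite /= P_mod1 Dstar_Preal//; exact: UD.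
by apply: UU; exists (P t) => //; rewrite /Fhat /= mod1_P.
Qed.

(** Pulling back along [P] respects disjointness, whichever invariance property
    [Q] is considered. *)
Lemma two_disjoint_torus (Q : set V -> Prop) (Q' : set T -> Prop) (S : set V) (S' : set T) :
  S `<=` D -> (forall t : T, S (P t) -> S' t) ->
  (forall U, U `<=` D -> Q U -> Q' (@P R n @^-1` U)) ->
  two_disjoint Q S -> two_disjoint Q' S'.
Proof.
move=> SD SS' QQ' [A [B [QA QB AS BS AB]]].
exists (@P R n @^-1` A), (@P R n @^-1` B); split.
- by apply: QQ' => //; exact: subset_trans SD.
- by apply: QQ' => //; exact: subset_trans SD.
- by move=> t /AS/SS'.
- by move=> t /BS/SS'.
- by rewrite -preimage_setI AB preimage_set0.
Qed.

Lemma two_disjoint_forward_invariant :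
  two_disjoint (forward_invariant (Fproj_dom F) (Fproj F)) (Fproj_dom F) ->
  two_disjoint (forward_invariant (range (@P R n)) (Fhat F)) D.
Proof.
move=> [A [B [FA FB AF BF AB]]].
have AI : A `<=` I by move=> x /AF[].
have BI : B `<=` I by move=> x /BF[].
exists (symmetrization A), (symmetrization B); split.
- exact: forward_invariant_symmetrization.
- exact: forward_invariant_symmetrization.
- exact: symmetrization_Dstar.
- exact: symmetrization_Dstar.
- exact: symmetrization_disjoint.
Qed.

End Symmetrization.

(** * Non-singularity *)

Section NullPreimages.
Variables (R : realType) (n : nat) (F : torus R n -> torus R n).
Local Notation V := 'rV[R]_n.+1.
Local Notation T := (torus R n).
Local Notation I := (@Iset R n).
Local Notation D := (@Dstar R n).
Local Notation null := (@Defs.null_set R n V id).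
Local Notation intv z := (map_mx (fun k : int => k%:~R : R) z).
Implicit Types (E : set V).

(** [Preal] moves each point by an integer vector, and there are countably many
    of those. *)
Lemma null_Preal_preimage E : null E -> null (@Preal R n @^-1` E).
Proof.
move=> E0; apply: (@null_sub _ _ _
  (\bigcup_(z : 'rV[int]_n.+1) ((fun x => x + intv z) @^-1` E))).
  by move=> x /=; have [z ->] := Preal_intv x => Ez; exists z.
by apply: null_bigcup_count => z; exact: null_preimage_translate.
Qed.

Lemma null_mod1_preimage E : null E -> Defs.null_set (@mod1 R n) (@P R n @^-1` E).
Proof.
move=> /null_Preal_preimage E0.
suff : null (@mod1 R n @^-1` (@P R n @^-1` E)) by [].
by apply: null_sub E0 => x; rewrite /= P_mod1.
Qed.

(** Outside [D], two coordinates differ by an integer: countably many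
    hyperplanes. *)
Lemma null_range_P_nDstar : null (range (@P R n) `\` D).
Proof.
apply: (@null_sub _ _ _ (\bigcup_(p : ('I_n.+1 * 'I_n.+1) * int)
  if p.1.1 != p.1.2 then [set x | x 0 p.1.1 = x 0 p.1.2 + p.2%:~R] else set0)).
  move=> u [[t _ <-]] /P_Dstar /existsNP[i /existsNP[j /not_implyP[ij /negP]]].
  rewrite negbK -{1 2}(mod1_P t) /mod1 [in X in X == _]mxE [in X in _ == X]mxE.
  rewrite -Quotient.idealrBE => /intrP[k e].
  by exists (i, j, k) => //=; rewrite ij /=; apply/eqP; rewrite addrC -subr_eq e.
apply: null_bigcup_count => -[[i j] k] /=; case: ifPn => [ij|_]; last exact: null0.
by apply: (null_graph (f := fun y => y + k%:~R)) ij _ => a b; rewrite opprD addrACA subrr addr0.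
Qed.

(** The hyperplane is a graph over a coordinate other than the last, which exists
    as [N >= 2]. *)
Lemma null_last0 : (2 <= n.+1)%N -> null [set x | x 0 ord_max = 0].
Proof.
move=> n2; apply: (@null_graph _ _ ord_max ord0 (fun=> 0)); last by move=> a b; rewrite subrr normr0.
by rewrite -val_eqE /= -lt0n.
Qed.

Hypothesis F_nonsingular : nonsingular (@mod1 R n) setT F.

Lemma null_Fhat_preimage E : null E -> null (Fhat F @^-1` E).
Proof.
move=> /null_mod1_preimage/F_nonsingular E0.
suff : null (@mod1 R n @^-1` (setT `&` F @^-1` (@P R n @^-1` E))) by apply: null_sub => x.
exact: E0.
Qed.

Lemma nonsingular_Fhat dom : nonsingular id dom (Fhat F).
Proof. by move=> E /null_Fhat_preimage; apply: null_sub => x []. Qed.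

(** [Fproj F] is at each point a permutation of [Fhat F]. *)
Lemma nonsingular_Fproj dom : nonsingular id dom (Fproj F).
Proof.
move=> E E0; apply: (@null_sub _ _ _
  (\bigcup_(s : 'S_n.+1) (Fhat F @^-1` (col_perm s @^-1` E)))) => [x [_ Ex]|].
  by exists (Defs.pi_of (Fhat F x)).
by apply: null_bigcup_count => s; exact/null_Fhat_preimage/null_preimage_perm.
Qed.

End NullPreimages.

(** * The pieces of Fhat *)

Section AtomicFamilies.
Variables (R : realType) (n : nat).
Local Notation V := 'rV[R]_n.+1.
Local Notation T := (torus R n).
Local Notation I := (@Iset R n).
Local Notation D := (@Dstar R n).
Local Notation null := (@Defs.null_set R n V id).
Implicit Types (M dom : set V) (B : set V) (f : V -> V).

Lemma polyhedron_sub_Dstar B : polyhedron B -> B `<=` D -> polytope B.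
Proof.
move=> Bp BD; split=> //; apply: (@coord_bounded_set _ _ _ 1) => x /BD.
exact: Dstar_coord_bounded.
Qed.

Lemma polytope_lift_id B : polytope B -> polytope_lift id B B.
Proof. by move=> Bp; split=> //; rewrite image_id. Qed.

Lemma polytope_lift_idE B A : polytope_lift id B A -> A = B.
Proof. by move=> [_ _ ->]; rewrite image_id. Qed.

Lemma affine_on_id B f g : affine_map g -> {in B, f =1 g} -> affine_on id B f.
Proof. by move=> [L [b gE]] fg; exists L, b => x Bx; rewrite fg ?inE. Qed.

(** Builds an atomic collection from pieces indexed by any finite type.
    Boundedness of the pieces comes from [M `<=` D]. *)
Lemma atomic_collection_finType M dom f (J : finType) (C : J -> set V) (g : J -> V -> V) :
  M `<=` D ->
  (forall j, open_polyhedron (C j)) -> (forall j, C j `<=` M `&` dom) ->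
  (forall i j, C i `&` C j !=set0 -> i = j) -> null (M `\` \bigcup_j C j) ->
  (forall j, affine_map (g j)) -> (forall j x, C j x -> f x = g j x /\ M (f x)) ->
  atomic_collection id M dom f (C \o @enum_val J predT).
Proof.
move=> MD Co CM Cdisj Cnull ga fg; split.
- move=> w; set j := enum_val w; exists (C j).
  have CD : C j `<=` D by move=> x /CM[/MD].
  split; [|exact: (Co j).2|].
    by apply/polytope_lift_id/polyhedron_sub_Dstar => //; exact: (Co j).1.
  by apply: affine_on_id (ga j) _ => x; rewrite inE => /fg[].
- by move=> w; exact: CM.
- by move=> i j _ _ /Cdisj /enum_val_inj.
- apply: null_sub Cnull => x [Mx nx]; split=> // -[j _ Cx]; apply: nx.
  by exists (enum_rank j) => //=; rewrite enum_rankK.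
- by move=> w _ [x /fg[_ ?] <-].
Qed.

(** The index set of the integer translations that can occur between bounded
    sets. *)
Lemma finite_int_cube (m : nat) : exists (K : finType) (v : K -> 'rV[int]_n.+1),
  injective v /\ forall z : 'rV[int]_n.+1, (forall i, `|z 0 i| <= m%:Z) -> exists k, v k = z.
Proof.
exists {ffun 'I_n.+1 -> 'I_(m + m).+1}, 
  (fun k : {ffun 'I_n.+1 -> 'I_(m + m).+1} => \row_i ((k i)%:Z - m%:Z)).
split=> [k1 k2 /rowP e|z zm].
  apply/ffunP => i; have := e i; rewrite !mxE => /addIr [] ?; exact: val_inj.
exists [ffun i => inord `|(z 0 i + m%:Z)%R|%N]; apply/rowP => i; rewrite !mxE ffunE.
have := zm i; rewrite ler_norml => /andP[zm1 zm2].
have z0 : 0 <= z 0 i + m%:Z by rewrite addrC -lerBlDl sub0r.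
rewrite inordK; first by rewrite gez0_abs// addrK.
by rewrite ltnS -lez_nat gez0_abs// PoszD lerD2r.
Qed.

End AtomicFamilies.

Section Cells.
Variables (R : realType) (n : nat) (F : torus R n -> torus R n).
Hypothesis n_ge2 : (2 <= n.+1)%N.
Hypothesis F_nonsingular : nonsingular (@mod1 R n) setT F.
Local Notation V := 'rV[R]_n.+1.
Local Notation T := (torus R n).
Local Notation I := (@Iset R n).
Local Notation D := (@Dstar R n).
Local Notation null := (@Defs.null_set R n V id).
Local Notation intv z := (map_mx (fun k : int => k%:~R : R) z).

(** Atoms of [F] read in R^N. The third property says that the atoms are
    disjoint modulo 1, the fourth that they cover almost every point modulo 1. *)
Lemma piecewise_affine_charts : piecewise_affine (@mod1 R n) setT setT F ->
  exists (m : nat) (B : 'I_m -> set V) (g : 'I_m -> V -> V),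
  [/\ forall w, [/\ polytope (B w), open (B w), set_inj (B w) (@mod1 R n) &
        affine_map (g w)],
      forall w x, B w x -> F (mod1 x) = mod1 (g w x),
      forall w w' x x', B w x -> B w' x' -> mod1 x = mod1 x' -> w = w' &
      null [set x | ~ exists w y, B w y /\ mod1 x = mod1 y]].
Proof.
move=> [m [A [hA _ Atriv Anull _]]].
have /choice[c cP] : forall w, exists c : set V * (V -> V),
    [/\ polytope_lift (@mod1 R n) c.1 (A w), open c.1, affine_map c.2 &
        forall x, c.1 x -> F (mod1 x) = mod1 (c.2 x)].
  move=> w; have [B [Bl Bo [L [b LbE]]]] := hA w.
  by exists (B, fun x => x *m L + b); split => //; exists L, b.
exists m, (fst \o c), (snd \o c); split.
- by move=> w; have [[? ? _] ? ? _] := cP w.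
- by move=> w x; have [_ _ _] := cP w; exact.
- move=> w w' x x' /= Bx Bx' xx'.
  have [[_ _ Aw] _ _ _] := cP w; have [[_ _ Aw'] _ _ _] := cP w'.
  apply: Atriv => //; exists (mod1 x); split; first by rewrite Aw; exists x.
  by rewrite Aw' xx'; exists x'.
- suff : null (@mod1 R n @^-1` (setT `\` \bigcup_w A w)).
    apply: null_sub => x /= nx; split=> // -[w _].
    have [[_ _ ->] _ _ _] := cP w => -[y By yx]; apply: nx.
    by exists w, y; rewrite yx.
  exact: Anull.
Qed.

Lemma int_shift_bounded (x y : V) (z : 'rV[int]_n.+1) (a b m : nat) :
  x = y + intv z -> (forall i, `|x 0 i| <= a%:R) -> (forall i, `|y 0 i| <= b%:R) ->
  (a + b <= m)%N -> forall i, `|z 0 i| <= m%:Z.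
Proof.
move=> xyz xa yb abm i; rewrite -(ler_int R) intr_norm.
have -> : (z 0 i)%:~R = x 0 i - y 0 i :> R by rewrite xyz !mxE addrAC subrr add0r.
apply: le_trans (ler_normB _ _) _; apply: le_trans (lerD (xa i) (yb i)) _.
by rewrite -natrD ler_nat.
Qed.

(** The piece of index [(w, z, k, s, p)] consists of the [x] sorted by [s] such
    that [x - z] is in the chart [B w] and that [h x := g w (x - z) + k] is
    sorted by [p]. There [Fhat F x = Preal (h x) = h x], as [h x] is in [D].
    Conversely [x] and [Fhat F x] determine the whole index, so that the pieces
    are disjoint: [w] and [z] because [mod1] is injective on the union of the
    charts, [k] by comparing [h x] with [Fhat F x], [s] and [p] by uniqueness of
    sorting. *)
Lemma Fhat_cells : piecewise_affine (@mod1 R n) setT setT F ->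
  exists (J : finType) (C : J -> set V) (g : J -> V -> V) (p : J -> 'S_n.+1),
  [/\ forall j, [/\ open_polyhedron (C j), C j `<=` D, affine_map (g j) &
        last_fixing (p j)],
      forall j x, C j x -> Fhat F x = g j x /\ I (col_perm (p j) (Fhat F x)),
      forall i j, C i `&` C j !=set0 -> i = j &
      null (D `\` \bigcup_j C j)].
Proof.
move=> /piecewise_affine_charts[m [B [g [Bg FE Bdisj Bnull]]]].
have /choice[b bP] : forall w, exists b : nat * nat,
    coord_bounded (B w) b.1 /\ coord_bounded (g w @` B w) b.2.
  move=> w; have [[/bounded_set_coord[b1 b1P] _] _ _ ga] := Bg w.
  by have [b2 b2P] := coord_bounded_affine ga b1P; exists (b1, b2).
(* [N] bounds the integer vectors that move a point of [B w], or of its image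
   under [g w], into [D], whose points have coordinates at most 1 in norm. *)
pose N := (\max_w ((b w).1 + (b w).2)).+1.
have bN w : (1 + ((b w).1 + (b w).2) <= N)%N.
  by rewrite add1n ltnS (leq_bigmax (F := fun w => ((b w).1 + (b w).2)%N) w).
have [K [v [v_inj v_surj]]] := @finite_int_cube n N.
pose G := {s : 'S_n.+1 | s ord_max == ord_max}.
have GP (s : G) : last_fixing (val s) by apply/eqP; exact: valP s.
pose J := ('I_m * K * K * G * G)%type.
pose w_ (j : J) := j.1.1.1.1; pose z_ (j : J) : V := intv (v j.1.1.1.2).
pose k_ (j : J) : V := intv (v j.1.1.2).
pose s_ (j : J) : 'S_n.+1 := val j.1.2; pose p_ (j : J) : 'S_n.+1 := val j.2.
pose h (j : J) x := g (w_ j) (x - z_ j) + k_ j.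
have ha j : affine_map (h j).
  apply: affine_comp (affine_translate _) _.
  by apply: affine_comp; [case: (Bg (w_ j))|exact: affine_translate].
pose C (j : J) := (col_perm (s_ j) @^-1` @Iopen R n) `&`
   ((fun x => x - z_ j) @^-1` B (w_ j)) `&` (h j @^-1` (col_perm (p_ j) @^-1` @Iopen R n)).
have Fh j x : B (w_ j) (x - z_ j) -> Fhat F x = Preal (h j x).
  by move=> Bx; rewrite /h /k_ Preal_translate -P_mod1 -FE// /z_ mod1_untranslate.
have Ch j x : C j x -> Fhat F x = h j x.
  move=> [[_ Bx] [hI _]]; rewrite (Fh j)// Dstar_Preal//.
  by apply: (Dstar_permE (GP j.2)); exact: Iset_Dstar.
exists J, C, h, p_; split.
- move=> j; split=> //; last exact: GP.
    apply: open_polyhedronI; first apply: open_polyhedronI.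
    + by apply: open_polyhedron_preimage (affine_perm _ _) _; exact: Iopen_open_polyhedron.
    + apply: open_polyhedron_preimage (affine_translate _) _.
      by have [[_ Bp] Bo _ _] := Bg (w_ j).
    + apply: open_polyhedron_preimage => //.
      by apply: open_polyhedron_preimage (affine_perm _ _) _; exact: Iopen_open_polyhedron.
  by move=> x [[[xI _] _] _]; apply: (Dstar_permE (GP j.1.2)); exact: Iset_Dstar.
- move=> j x Cx; rewrite (Ch j)//; split=> //.
  by have [_ []] := Cx.
- move=> i j [x [Ci Cj]].
  have := Ch _ _ Ci; have := Ch _ _ Cj => -> hij.
  have [[[si _] Bi] [pi _]] := Ci; have [[[sj _] Bj] [pj _]] := Cj.
  have ew : w_ i = w_ j.
    by apply: (Bdisj _ _ (x - z_ i) (x - z_ j)) => //; rewrite /z_ !mod1_untranslate.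
  have ez : v i.1.1.1.2 = v j.1.1.1.2.
    have [_ _ Binj _] := Bg (w_ i).
    have : x - z_ i = x - z_ j.
      apply: Binj; [by rewrite inE|by rewrite inE ew|].
      by rewrite /z_ !mod1_untranslate.
    by move=> /addrI/oppr_inj/intv_inj.
  have ek : v i.1.1.2 = v j.1.1.2.
    by move: hij; rewrite /h ew /z_ ez => /addrI/intv_inj.
  have es : i.1.2 = j.1.2 by apply/val_inj; exact: Iset_perm_unique si sj.
  have ep : i.2 = j.2.
    by apply/val_inj; rewrite /preimage /= hij in pj; exact: Iset_perm_unique pi pj.
  move: ew ez ek es ep; rewrite /w_; case: i {Ci si Bi pi hij} => -[[[w z] k] s] p.
  by case: j {Cj sj Bj pj} => -[[[w' z'] k'] s'] p' /= -> /v_inj -> /v_inj -> -> ->.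
- pose Z := [set x : V | x 0 ord_max = 0].
  apply: (@null_sub _ _ _ ([set x | ~ exists w y, B w y /\ mod1 x = mod1 y] `|`
    ((Fhat F @^-1` (range (@P R n) `\` D)) `|`
     (Z `|` Fhat F @^-1` Z)))); last first.
    apply: nullU => //; apply: nullU.
      by apply: null_Fhat_preimage => //; exact: null_range_P_nDstar.
    by apply: nullU; [|apply: null_Fhat_preimage => //]; exact: null_last0.
  move=> x [Dx nC]; apply: contrapT => /not_orP[/contrapT[w [y [By xy]]]].
  move=> /not_orP[FD /not_orP[/= x0 Fx0]]; apply: nC.
  have {}FD : D (Fhat F x).
    by apply: contrapT => nD; apply: FD; split=> //; exists (F (mod1 x)).
  have [s sl sI] := Dstar_sort Dx; have [p pl pI] := Dstar_sort FD.
  have Iopen_sort q u : last_fixing q -> I (col_perm q u) -> u 0 ord_max != 0 ->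
      Iopen (col_perm q u).
    move=> ql qI u0; split=> //=; have [/andP[]] := qI.
    by rewrite mxE ql => u00 _ _ _; rewrite lt_neqAle eq_sym u0.
  have [z xyz] := mod1_eq xy.
  have Fxy : Fhat F x = Preal (g w y) by rewrite /Fhat /= xy (FE w)// P_mod1.
  have [k gk] := Preal_intv (g w y).
  have [zi ziE] : exists i, v i = z.
    apply/v_surj; apply: (int_shift_bounded xyz (a := 1) (b := (b w).1)).
    - exact: Dstar_coord_bounded.
    - by have [+ _] := bP w; apply.
    - by apply: leq_trans (bN w); rewrite leq_add2l leq_addr.
  have [ki kiE] : exists i, v i = k.
    apply/v_surj; apply: (int_shift_bounded gk (a := 1) (b := (b w).2)).
    - by rewrite -Fxy; exact: Dstar_coord_bounded.
    - by have [_ +] := bP w; apply; exists y.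
    - by apply: leq_trans (bN w); rewrite leq_add2l leq_addl.
  have sG : s ord_max == ord_max by apply/eqP.
  have pG : p ord_max == ord_max by apply/eqP.
  pose j : J := (w, zi, ki, exist _ s sG, exist _ p pG).
  have xz : x - z_ j = y by rewrite /z_ /= ziE xyz addrK.
  have hx : h j x = Fhat F x by rewrite /h xz /k_ /= kiE -gk -Fxy.
  exists j => //; split; last by rewrite /preimage /= hx; apply: Iopen_sort => //; exact/eqP.
  by split; [apply: Iopen_sort => //; exact/eqP|rewrite /preimage /= xz].
Qed.

End Cells.

(** * Piecewise affinity and invariant unions of polytopes *)

Section InvariantUnions.
Variables (R : realType) (n : nat) (F : torus R n -> torus R n).
Hypothesis n_ge2 : (2 <= n.+1)%N.
Hypothesis F_nonsingular : nonsingular (@mod1 R n) setT F.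
Hypothesis F_affine : piecewise_affine (@mod1 R n) setT setT F.
Local Notation V := 'rV[R]_n.+1.
Local Notation T := (torus R n).
Local Notation I := (@Iset R n).
Local Notation D := (@Dstar R n).
Local Notation null := (@Defs.null_set R n V id).
Implicit Types U : set V.

Lemma piecewise_affine_Fhat : piecewise_affine id D (range (@P R n)) (Fhat F).
Proof.
have [J [C [g [p [CP FC Cdisj Cnull]]]]] := Fhat_cells n_ge2 F_nonsingular F_affine.
exists #|J|, (C \o enum_val); apply: (@atomic_collection_finType _ _ _ _ _ _ _ g) => //.
- by move=> j; have [] := CP j.
- move=> j x Cx; have [_ CD _ _] := CP j.
  by split; [exact: CD|exact: Dstar_range (CD _ Cx)].
- by move=> j; have [] := CP j.
- move=> j x Cx; have [? FI] := FC j x Cx; split=> //.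
  by have [_ _ _ pl] := CP j; apply: (Dstar_permE pl); exact: Iset_Dstar.
Qed.

(** On the piece of index [j], the permutation [p j] sorts the image, so that
    [Fproj F] is there [col_perm (p j) \o g j]. The pieces are cut with [Iopen] to
    lie in [I]. *)
Lemma piecewise_affine_Fproj : piecewise_affine id I (Fproj_dom F) (Fproj F).
Proof.
have [J [C [g [p [CP FC Cdisj Cnull]]]]] := Fhat_cells n_ge2 F_nonsingular F_affine.
exists #|J|, ((fun j => C j `&` @Iopen R n) \o enum_val).
apply: (@atomic_collection_finType _ _ _ _ _ _ _ (fun j => col_perm (p j) \o g j)).
- exact: Iset_Dstar.
- move=> j; have [Co _ _ _] := CP j.
  by apply: open_polyhedronI => //; exact: Iopen_open_polyhedron.
- move=> j x [Cx [xI _]]; split=> //; split=> //.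
  have [_ FI] := FC j x Cx; have [_ _ _ pl] := CP j.
  by apply: (Dstar_permE pl); exact: Iset_Dstar.
- by move=> i j [x [[Ci _] [Cj _]]]; apply: Cdisj; exists x.
- apply: null_sub (nullU Cnull (null_last0 R n_ge2)) => x [xI nx].
  have [x0|x0] := pselect (x 0 ord_max = 0); [by right|left].
  split=> [|[j _ Cx]]; first exact: Iset_Dstar.
  apply: nx; exists j => //; split=> //; split=> //=.
  by have [/andP[]] := xI; rewrite le_eqVlt => /predU1P[/esym|].
- by move=> j; have [_ _ ga _] := CP j; apply: affine_comp ga; exact: affine_perm.
- move=> j x [Cx _]; have [Fg FI] := FC j x Cx; have [_ _ _ pl] := CP j.
  by rewrite /Fproj (pi_of_eq pl FI) /= -Fg.
Qed.

Lemma ord_surjection (J : finType) (j0 : J) :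
  exists (K : nat) (e : 'I_K.+1 -> J), forall j, exists k, e k = j.
Proof.
exists #|J|, (fun k => nth j0 (enum J) k) => j.
have jJ : (index j (enum J) < #|J|.+1)%N by rewrite ltnS cardE index_size.
by exists (Ordinal jJ); rewrite /= nth_index// mem_enum.
Qed.

Lemma interior_perm (s : 'S_n.+1) U : U° !=set0 -> (col_perm s @^-1` U)° !=set0.
Proof.
move=> [x Ux]; exists (col_perm s^-1%g x).
suff : col_perm s @^-1` U° `<=` (col_perm s @^-1` U)° by apply; rewrite /preimage /= col_permKV.
rewrite -open_subsetE; first by move=> y; exact: interior_subset.
apply: open_comp => [y _|]; last exact: open_interior.
exact: affine_continuous (affine_perm _ _) y.
Qed.

Hypothesis F_commutes : forall s, last_fixing s ->
  forall t : T, F (col_perm s t) = col_perm s (F t).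

(** The atoms [A] of [Fproj F] cannot be used directly, even permuted: on them
    [Fhat F] is a permutation of an affine map, but this permutation may vary.
    They are therefore intersected with the pieces of [Fhat F]. If [x] is in a
    permuted polytope and in a permuted atom, the two permutations agree by
    uniqueness of sorting, and the invariance under [Fproj F] applies at the
    sorted point. *)
Lemma IUP_symmetrization U : U `<=` Fproj_dom F ->
  is_IUP id I (Fproj_dom F) (Fproj F) U ->
  is_IUP id D (range (@P R n)) (Fhat F) (symmetrization U).
Proof.
move=> UF [K [W [WP UW [m [A [[Alift AI Atriv Anull _] AU]]]]]].
have Ao w : open_polyhedron (A w).
  by have [B [BA Bo _]] := Alift w; rewrite (polytope_lift_idE BA); split=> //; case: BA => -[].
pose G := {s : 'S_n.+1 | s ord_max == ord_max}.
have GP (s : G) : last_fixing (val s) by apply/eqP; exact: valP s.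
have G1 : (1%g : 'S_n.+1) ord_max == ord_max by rewrite perm1.
have WI k : W k `<=` I by have [] := WP k.
have permD s x : last_fixing s -> I (col_perm s x) -> D x.
  by move=> sl xI; apply: (Dstar_permE sl); exact: Iset_Dstar.
have [K' [e e_surj]] := ord_surjection ((exist _ 1%g G1, ord0) : G * 'I_K.+1).
exists K', (fun k => col_perm (val (e k).1) @^-1` W (e k).2); split.
- move=> k; have [_ [B Bl B0]] := WP (e k).2; rewrite (polytope_lift_idE Bl).
  have WD : col_perm (val (e k).1) @^-1` B `<=` D.
    move=> x Bx; apply: (permD _ _ (GP (e k).1)); apply: (WI (e k).2).
    by rewrite (polytope_lift_idE Bl).
  split=> //; exists (col_perm (val (e k).1) @^-1` B); last exact: interior_perm.
  apply/polytope_lift_id/polyhedron_sub_Dstar => //.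
  by apply: polyhedron_preimage (affine_perm _ _) _; case: Bl => -[].
- apply/seteqP; split => x.
    move=> [s sl]; rewrite UW => -[k _ Wx].
    have sG : s ord_max == ord_max by apply/eqP.
    have [k' ek] := e_surj (exist _ s sG, k).
    by exists k' => //; rewrite ek.
  by move=> [k _ Wx]; exists (val (e k).1); [exact: GP|rewrite UW; exists (e k).2].
have [J [C [g [p [CP FC Cdisj Cnull]]]]] := Fhat_cells n_ge2 F_nonsingular F_affine.
pose A' (j : J * G * 'I_m) := C j.1.1 `&` col_perm (val j.1.2) @^-1` A j.2.
exists #|{: J * G * 'I_m}|, (A' \o enum_val); split.
  apply: (@atomic_collection_finType _ _ _ _ _ _ _ (fun j => g j.1.1)) => //.
  - move=> -[[j s] w]; apply: open_polyhedronI; first by have [] := CP j.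
    exact: open_polyhedron_preimage (affine_perm _ _) (Ao w).
  - move=> -[[j s] w] x [Cx _]; have [_ CD _ _] := CP j.
    by split; [exact: CD|exact: Dstar_range (CD _ Cx)].
  - move=> -[[j s] w] [[j' s'] w'] [x [[/= Cx Ax] [/= Cx' Ax']]].
    have -> : j = j' by apply: Cdisj; exists x.
    have ss' : s = s'.
      by apply/val_inj/(@Iset_perm_unique _ _ _ _ x); [have [] := AI _ _ Ax|have [] := AI _ _ Ax'].
    move: Ax Ax'; rewrite -ss' => Ax Ax'; congr (_, _).
    by apply: Atriv => //; exists (col_perm (val s) x).
  - apply: (@null_sub _ _ _ ((D `\` \bigcup_j C j) `|`
      (\bigcup_(s : 'S_n.+1) (col_perm s @^-1` (I `\` \bigcup_w A w))))); last first.
      by apply: nullU => //; apply: null_bigcup_count => s; exact: null_preimage_perm.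
    move=> x [Dx nx]; have [[j _ Cx]|nC] := pselect ((\bigcup_j C j) x); last by left.
    right; have [s sl sI] := Dstar_sort Dx; exists s => //; split=> // -[w _ Ax].
    have sG : s ord_max == ord_max by apply/eqP.
    by apply: nx; exists (j, exist _ s sG, w).
  - by move=> -[[j s] w]; have [] := CP j.
  - move=> -[[j s] w] x [Cx _]; have [? FI] := FC j x Cx; split=> //.
    by have [_ _ _ pl] := CP j; exact: permD pl FI.
move=> _ [x [k _ [w _ [Wx [_ Ax]]]] <-].
have [/= _ xF] := AI _ _ Ax.
have es : val (e k).1 = val (enum_val w).1.2.
  by apply: (@Iset_perm_unique _ _ _ _ x); [exact: WI Wx|have [] := AI _ _ Ax].
apply: (@symmetrization_Fhat _ _ _ F_commutes _ (val (e k).1)); first exact: GP.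
apply: AU; exists (col_perm (val (e k).1) x) => //.
by exists (e k).2 => //; exists (enum_val w).2 => //; split=> //; rewrite es.
Qed.

Lemma two_disjoint_IUP :
  two_disjoint (is_IUP id I (Fproj_dom F) (Fproj F)) (Fproj_dom F) ->
  two_disjoint (is_IUP id D (range (@P R n)) (Fhat F)) (D `&` Fhat F @^-1` D).
Proof.
move=> [U [U' [UP UP' UF UF' UU']]].
have UI : U `<=` I by move=> x /UF[].
have UI' : U' `<=` I by move=> x /UF'[].
exists (symmetrization U), (symmetrization U'); split.
- exact: IUP_symmetrization.
- exact: IUP_symmetrization.
- by move=> x Ux; split; [exact: symmetrization_Dstar Ux|exact: symmetrization_Fhat_Dstar Ux].
- by move=> x Ux; split; [exact: symmetrization_Dstar Ux|exact: symmetrization_Fhat_Dstar Ux].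
- exact: symmetrization_disjoint.
Qed.

Lemma mod1_inj_Dstar U : U `<=` D -> set_inj U (@mod1 R n).
Proof.
move=> UD x y; rewrite !inE => /UD/Dstar_Preal xE /UD/Dstar_Preal yE e.
by rewrite -xE -yE -!P_mod1 e.
Qed.

Lemma image_mod1 U : U `<=` D -> @mod1 R n @` U = @P R n @^-1` U.
Proof.
move=> UD; apply/seteqP; split => [_ [u Uu <-]|t Ut]; last by exists (P t) => //; exact: mod1_P.
by rewrite /preimage /= P_mod1 Dstar_Preal//; exact: UD.
Qed.

Lemma polytope_lift_torus B U : U `<=` D -> polytope_lift id B U ->
  polytope_lift (@mod1 R n) B (@P R n @^-1` U).
Proof.
move=> UD BU; have E := polytope_lift_idE BU; case: BU => Bp _ _.
by split=> //; rewrite -?image_mod1 -?E//; exact: mod1_inj_Dstar.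
Qed.

(** The polytopes and the atoms of [Fhat F] are themselves charts of their images
    in the torus, as [mod1] is injective on [D]. *)
Lemma IUP_torus U : U `<=` D -> is_IUP id D (range (@P R n)) (Fhat F) U ->
  is_IUP (@mod1 R n) setT setT F (@P R n @^-1` U).
Proof.
move=> UD [K [W [WP UW [m [A [[Alift AD Atriv Anull _] AU]]]]]].
have AD' w : A w `<=` D by move=> x /AD[].
exists K, (fun k => @P R n @^-1` W k); split.
- move=> k; split=> //; have [WD [B Bl B0]] := WP k.
  by exists B => //; exact: polytope_lift_torus.
- by rewrite UW preimage_bigcup.
exists m, (fun w => @P R n @^-1` A w); split.
  split=> //.
  - move=> w; have [B [Bl Bo [L [b LbE]]]] := Alift w; exists B; split=> //.
      exact: polytope_lift_torus.
    by exists L, b => x Bx; rewrite -(LbE x Bx) /Fhat /= mod1_P.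
  - move=> i j _ _ [t [Ai Aj]]; apply: Atriv => //.
    by exists (P t).
  - have N0 : null (@mod1 R n @^-1` (@P R n @^-1`
        ((D `\` \bigcup_w A w) `|` (range (@P R n) `\` D)))).
      exact: null_mod1_preimage (nullU Anull (null_range_P_nDstar R n)).
    suff : null (@mod1 R n @^-1` (setT `\` \bigcup_w (@P R n @^-1` A w))) by [].
    apply: null_sub N0 => x [_ nx]; rewrite /preimage /=.
    have [Dx|nD] := pselect (D (P (mod1 x))); last by right; split=> //; exists (mod1 x).
    by left; split=> // -[w _ Ax]; apply: nx; exists w.
move=> _ [t [k _ [w _ [Wt At]]] <-].
apply: AU; exists (P t); last by rewrite /Fhat /= mod1_P.
by exists k => //; exists w.
Qed.

End InvariantUnions.

Theorem lemma2p2 (R : realType) (n : nat) (N_ge2 : (2 <= n.+1)%N)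
    (F : torus R n -> torus R n)
    (F_nonsingular : nonsingular (@mod1 R n) setT F)
    (F_commutes : forall s : 'S_n.+1, last_fixing s ->
       forall u : torus R n, F (col_perm s u) = col_perm s (F u)) :
  (two_disjoint (forward_invariant (Fproj_dom F) (Fproj F)) (Fproj_dom F) ->
     two_disjoint (forward_invariant (range (@P R n)) (Fhat F)) (@Dstar R n) /\
     two_disjoint (forward_invariant setT F) (@tstar R n))
  /\
  (piecewise_affine (@mod1 R n) setT setT F ->
     [/\ nonsingular id (range (@P R n)) (Fhat F),
         piecewise_affine id (@Dstar R n) (range (@P R n)) (Fhat F),
         nonsingular id (Fproj_dom F) (Fproj F),
         piecewise_affine id (@Iset R n) (Fproj_dom F) (Fproj F) &
         two_disjoint (is_IUP id (@Iset R n) (Fproj_dom F) (Fproj F))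
                      (Fproj_dom F) ->
           two_disjoint (is_IUP id (@Dstar R n) (range (@P R n)) (Fhat F))
                        (@Dstar R n `&` Fhat F @^-1` @Dstar R n) /\
           two_disjoint (is_IUP (@mod1 R n) setT setT F)
                        (@tstar R n `&` F @^-1` @tstar R n)]).
Proof.
split=> [/(two_disjoint_forward_invariant F_commutes) hD|F_affine].
  split=> //; apply: two_disjoint_torus hD => [//|t /P_Dstar//|U].
  exact: forward_invariant_torus.
split.
- exact: nonsingular_Fhat.
- exact: piecewise_affine_Fhat.
- exact: nonsingular_Fproj.
- exact: piecewise_affine_Fproj.
move=> /(two_disjoint_IUP N_ge2 F_nonsingular F_affine F_commutes) hD.
split=> //; apply: two_disjoint_torus hD => [x [] //|t [/P_Dstar tD]|U].
  by rewrite /preimage /= /Fhat /= mod1_P => /P_Dstar.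
exact: IUP_torus.
Qed.
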